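(* Let $d\ge 1$, let $S \subset \mathbb{Z}^d$ be a bounded set and let $x \in S$. Then the number of lattice diameter segments of $S$ that have $x$ as an endpoint is at most $2^d - 1$. Therefore $\Delta(\mathsf{BG}_{\mathbb{Z}}(S)) \leq 2^d - 1$, where $\Delta$ denotes the maximum degree of a graph. The bound $2^d-1$ on the number of lattice diameter segments with a given endpoint is best possible: for every $d \ge 1$ there exist a bounded set $S \subset \mathbb{Z}^d$ and a point $x \in S$ such that exactly $2^d-1$ lattice diameter segments of $S$ have $x$ as an endpoint.
   Context: For a bounded non-empty set $S \subset \mathbb{Z}^d$, the lattice diameter is $\operatorname{diam}_{\mathbb{Z}}(S) := \max_{x,y \in S} |\operatorname{conv}(\{x,y\}) \cap \mathbb{Z}^d| - 1$. If $x,y \in S$ attain this maximum, then the segment $\operatorname{conv}(\{x,y\})$ is a lattice diameter segment of $S$, with endpoints $x$ and $y$. The lattice Borsuk graph $\mathsf{BG}_{\mathbb{Z}}(S)$ is the simple undirected graph with vertex set $S$ in which two distinct points $x,y \in S$ are adjacent if and only if $|\operatorname{conv}(\{x,y\}) \cap \mathbb{Z}^d| - 1 = \operatorname{diam}_{\mathbb{Z}}(S)$. *)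

(* Defs.v *)
From mathcomp Require Import all_boot all_order all_algebra finmap.
From mathcomp Require Import all_classical all_reals all_analysis.

Set Implicit Arguments.
Unset Strict Implicit.
Unset Printing Implicit Defensive.

Import Order.TTheory GRing.Theory Num.Theory numFieldNormedType.Exports.

Local Open Scope classical_set_scope.
Local Open Scope ring_scope.

(* [xget] returns the unique maximum of [A]; the junk value 0 is only reached
   when [A] is empty or unbounded. *)
Definition nat_max (A : set nat) : nat := xget 0%N (A `&` ubound A).

(* [fset_set] is meant for finite sets; it is [fset0] on infinite ones. *)
Definition ncard (T : choiceType) (A : set T) : nat := #|` fset_set A|.

(* Graphs are simple; the vertex set is a subset of an ambient type. *)
Record sgraph (T : choiceType) := SGraph {
  vertex : set T;
  adj : T -> T -> Prop;
  adj_vertex : forall x y, adj x y -> vertex x /\ vertex y;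
  adj_sym : forall x y, adj x y -> adj y x;
  adj_irrefl : forall x, ~ adj x x
}.

Definition degree (T : choiceType) (G : sgraph T) (x : T) : nat :=
  ncard [set y | adj G x y].

Definition max_degree (T : choiceType) (G : sgraph T) : nat :=
  nat_max [set degree G x | x in vertex G].

Section Lattice.
Variables (R : realType) (d : nat).
Implicit Types (S : set 'rV[int]_d) (x y : 'rV[int]_d).

Definition to_real x : 'rV[R]_d := map_mx intr x.

Definition bounded_lattice S : Prop := bounded_set (to_real @` S).

Definition convex_hull (A : set 'rV[R]_d) : set 'rV[R]_d :=
  smallest (fun B : set 'rV[R]_d => convex_set B) A.

Definition segment x y : set 'rV[R]_d :=
  convex_hull [set to_real x; to_real y].

(* The truncated predecessor is harmless: the segment contains [x]. *)
Definition lattice_length x y : nat :=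
  (ncard (segment x y `&` range to_real)).-1.

Definition lattice_diam S : nat :=
  nat_max [set n | exists x y, [/\ S x, S y & n = lattice_length x y]].

Definition attains_diam S x y : Prop :=
  [/\ S x, S y & lattice_length x y = lattice_diam S].

(* Segments are counted as subsets of R^d. *)
Definition diam_segments_at S x : set (set 'rV[R]_d) :=
  [set L | exists y, attains_diam S x y /\ L = segment x y].

Definition borsuk_adj S x y : Prop := x <> y /\ attains_diam S x y.

Lemma borsuk_adj_vertex S x y : borsuk_adj S x y -> S x /\ S y.
Proof. by case=> _ [Sx Sy _]. Qed.

Lemma borsuk_adj_sym S x y : borsuk_adj S x y -> borsuk_adj S y x.
Proof.
case=> xy [Sx Sy xyE]; split; first by move/esym.
by split=> //; rewrite -xyE /lattice_length /segment setUC.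
Qed.

Lemma borsuk_adj_irrefl S x : ~ borsuk_adj S x x.
Proof. by case. Qed.

Definition borsuk_graph S : sgraph 'rV[int]_d :=
  SGraph (@borsuk_adj_vertex S) (@borsuk_adj_sym S) (@borsuk_adj_irrefl S).

End Lattice.

Arguments diam_segments_at R {d} S x _ : rename.

(* Main.v *)
(* Since conv{x, y} contains gcd(y - x) + 1 lattice points, a lattice point y at
   maximal distance D from x has the form x + D v with v integral.  If two such
   points have v = v' mod 2, or one has v = 0 mod 2, then two points of S differ
   by a multiple of 2D, hence coincide if D > 0.  So y |-> v mod 2 is an
   injection into the 2^d - 1 nonzero classes.  The cube {0,1}^d has diameter 1
   and is extremal at the origin. *)
Require Import Defs.
From mathcomp Require Import all_boot all_order all_algebra finmap.
From mathcomp Require Import all_classical all_reals all_analysis.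
From mathcomp Require Import unstable zify ring lra.

Local Open Scope classical_set_scope.
Local Open Scope card_scope.

Section LatticeDiameter.
Set Implicit Arguments.
Unset Strict Implicit.
Import Order.TTheory GRing.Theory Num.Theory numFieldNormedType.Exports.
Local Open Scope ring_scope.

(** * Gcd of the coordinates of an integer row *)

Section RowGcd.
Variable d : nat.
Implicit Types z v : 'rV[int]_d.

Definition row_gcd z : nat := \big[gcdn/0%N]_i `|z 0%R i|%N.

Lemma row_gcd_dvd z i : (row_gcd z %| `|z 0%R i|)%N.
Proof. exact: (biggcdn_inf i). Qed.

Lemma row_gcd0 z : row_gcd z = 0%N -> z = 0.
Proof.
move=> z0; apply/rowP => i; rewrite mxE.
by have := row_gcd_dvd z i; rewrite z0 dvd0n absz_eq0 => /eqP.
Qed.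

Lemma row_gcd_scale (m : nat) v : row_gcd (m%:Z *: v) = (m * row_gcd v)%N.
Proof.
rewrite /row_gcd (big_endo (muln m)) ?muln0 //.
  by apply: eq_bigr => i _; rewrite mxE abszM.
by move=> a b; rewrite muln_gcdr.
Qed.

(** Division by 0 yields 0, so the zero row is sent to itself. *)
Definition primitive_row z : 'rV[int]_d := \row_i (z 0%R i %/ (row_gcd z)%:Z)%Z.

Lemma scale_primitive_row z : (row_gcd z)%:Z *: primitive_row z = z.
Proof.
apply/rowP => i; rewrite !mxE mulrC divzK //.
exact: row_gcd_dvd.
Qed.

Lemma row_gcd_le z (N : nat) :
  (forall i, `|z 0%R i| <= N)%N -> (row_gcd z <= N)%N.
Proof.
move=> zN; have [->//|z0] := eqVneq (row_gcd z) 0%N.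
have [i zi] : exists i, z 0 i != 0.
  apply/not_existsP => z_0; case/eqP: z0; apply: big1 => i _.
  by apply/eqP; rewrite absz_eq0; apply/negPn/negP/z_0.
by rewrite (leq_trans _ (zN i))// dvdn_leq ?row_gcd_dvd// absz_gt0.
Qed.

(** By Bézout, the naturals [n] with [t * n] integral are closed under gcd. *)
Lemma row_gcd_int (R : realType) (t : R) z :
  (forall i, t * (z 0%R i)%:~R \is a Num.int) ->
  t * (row_gcd z)%:R \is a Num.int.
Proof.
move=> tz; pose K n := t * n%:R \is a Num.int.
apply: (@big_ind _ K 0%N gcdn) => [|m n tm tn|i _]; rewrite /K.
- by rewrite mulr0 rpred0.
- have [u [v uv]] := Bezoutz m%:Z n%:Z.
  have -> : (gcdn m n)%:R = u%:~R * m%:R + v%:~R * n%:R :> R.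
    by rewrite -[RHS]/(u%:~R * m%:Z%:~R + v%:~R * n%:Z%:~R)
       -!rmorphM -rmorphD uv.
  by rewrite mulrDr !(mulrCA t) rpredD// rpredM// intr_int.
- rewrite natr_absz normrEsign rmorphMsign mulrCA rpredMsign; exact: tz.
Qed.

End RowGcd.

(** * Lattice points on a segment *)

Section LatticeLength.
Variables (R : realType) (d : nat).
Implicit Types (x y : 'rV[int]_d) (S : set 'rV[int]_d).

Lemma segmentE x y : segment x y =
  [set to_real R x + t *: to_real R (y - x) | t in [set t : R | 0 <= t <= 1]].
Proof.
apply/seteqP; split.
  apply: smallest_sub.
    move=> a b l; rewrite !inE => -[s /andP[s0 s1] <-] [t /andP[t0 t1] <-].
    have l0 : 0 <= l%:num :> R by [].
    have l1 : l%:num <= 1 :> R by [].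
    exists (l%:num * s + (1 - l%:num) * t); first by apply/andP; split; nra.
    apply/rowP => i; rewrite /conv/= !mxE /onem; ring.
  move=> _ [->|->]; [exists 0; first by rewrite /= lexx ler01|].
    by rewrite scale0r addr0.
  exists 1; first by rewrite /= ler01 lexx.
  by apply/rowP => i; rewrite !mxE rmorphB/= mul1r addrC subrK.
move=> _ [t /andP[t0 t1] <-] B [cB sB].
(* A convex combination puts its parameter on the first point, here [x], so the parameter is
   [1 - t]. *)
have t'0 : 0 <= 1 - t by rewrite subr_ge0.
have t'1 : 1 - t <= 1 by rewrite lerBlDr lerDl.
have := cB (to_real R x) (to_real R y) (Itv01 t'0 t'1).
rewrite !inE => /(_ (sB _ (or_introl erefl)) (sB _ (or_intror erefl))).
congr B; apply/rowP => i; rewrite /conv/= !mxE /onem rmorphB/=; ring.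
Qed.

(** If [x + t *: z] is a lattice point, every [t * z i] is an integer, hence so is [t * g] for the
    gcd [g] of [z]; this integer is the index [k]. *)
Lemma segment_lattice_points x y : @segment R d x y `&` range (@to_real R d) =
  (fun k : nat => to_real R (x + k%:Z *: primitive_row (y - x))) @`
    `I_(row_gcd (y - x)).+1.
Proof.
rewrite segmentE; move: (y - x) => z; have := scale_primitive_row z.
move: (primitive_row z) => u; set g := row_gcd z => gu.
have zE i : (z 0 i)%:~R = g%:R * (u 0 i)%:~R :> R.
  by rewrite -{1}gu mxE rmorphM.
apply/seteqP; split.
  move=> p [] [t /andP[t0 t1] <-] [q _ /rowP qE].
  have /natrP[k kE] : t * g%:R \is a Num.nat.
    rewrite natrEint mulr_ge0// andbT; apply: row_gcd_int => i.
    have /(congr1 (fun r => r - (x 0 i)%:~R)) := qE i.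
    rewrite !mxE addrAC subrr add0r -rmorphB/= => <-; exact: intr_int.
  exists k; first by rewrite /= ltnS -(ler_nat R) -kE ler_piMl.
  by apply/rowP => i; rewrite !mxE rmorphD rmorphM/= zE mulrA kE.
move=> _ [k /= kg <-]; split; last by exists (x + k%:Z *: u).
(* If [g = 0], this quotient is 0 by convention and [k = 0] is the only index, so both sides are
   [x]. *)
exists (k%:R / g%:R).
  rewrite /= divr_ge0//=; have [->|g0] := posnP g; first by rewrite invr0 mulr0.
  by rewrite ler_pdivrMr ?ltr0n// mul1r ler_nat.
apply/rowP => i; rewrite !mxE rmorphD rmorphM/= zE mulrA.
have [g0|g0] := posnP g; last by rewrite divfK// pnatr_eq0 -lt0n.
by move: kg; rewrite g0 ltnS leqn0 => /eqP->; rewrite !mul0r.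
Qed.

Lemma to_real_inj : injective (@to_real R d).
Proof.
move=> x y /rowP xy; apply/rowP => i.
by have := xy i; rewrite !mxE => /eqP; rewrite eqr_int => /eqP.
Qed.

Lemma lattice_lengthE x y : lattice_length R x y = row_gcd (y - x).
Proof.
rewrite /lattice_length /ncard segment_lattice_points.
set z := y - x; rewrite (_ : #|` _| = (row_gcd z).+1)//.
apply/card_fset_set/inj_card_eq => j k; rewrite !inE/= => jg kg.
move=> /to_real_inj/addrI/rowP E.
have [g0|g0] := posnP (row_gcd z).
  by move: jg kg; rewrite g0 !ltnS !leqn0 => /eqP-> /eqP->.
(* A nonzero coordinate of the primitive row separates the indices, so the [row_gcd z + 1] points
   are distinct. *)
have : primitive_row z != 0.
  apply: contraTneq g0 => u0; rewrite -(scale_primitive_row z) u0 scaler0.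
  by rewrite /row_gcd big1// => i _; rewrite mxE.
move=> /rV0Pn[i ui].
have jk : j%:Z * primitive_row z 0 i = k%:Z * primitive_row z 0 i.
  by have := E i; rewrite !mxE.
by case: (mulIf ui jk).
Qed.

End LatticeLength.

(** * Maxima of sets of naturals, and the list of nonzero classes *)

Lemma nat_maxP (A : set nat) (N : nat) : A !=set0 -> ubound A N ->
  A (nat_max A) /\ ubound A (nat_max A).
Proof.
move=> [a Aa] AN; apply: (@xgetPex _ 0%N (A `&` ubound A)).
have Aex : exists n, `[< A n >] by exists a; apply/asboolP.
have Aub n : `[< A n >] -> (n <= N)%N by move/asboolP/AN.
case: (ex_maxnP Aex Aub) => m /asboolP Am mub; exists m; split=> // n An.
exact/mub/asboolP.
Qed.

Lemma nat_max_eq (A : set nat) (n : nat) : A n -> ubound A n -> nat_max A = n.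
Proof.
move=> An An_ub; have [Am Am_ub] := @nat_maxP A n (ex_intro _ n An) An_ub.
by apply/eqP; rewrite eqn_leq
  [X in X && _](An_ub _ Am) [X in _ && X](Am_ub _ An).
Qed.

(* The nonzero classes mod 2, encoded by their odd coordinates. *)
Definition nonempty_sets (d : nat) : seq {set 'I_d} :=
  enum (predC1 (@finset.set0 'I_d)).

Lemma size_nonempty_sets d : size (nonempty_sets d) = (2 ^ d - 1)%N.
Proof.
rewrite -cardE cardC1 -cardsT -powersetT card_powerset cardsT card_ord.
by rewrite subn1.
Qed.

(** * Parity classes of the diameter directions *)

Section Diameter.
Variables (R : realType) (d : nat).
Implicit Types (x y : 'rV[int]_d) (S : set 'rV[int]_d).

Lemma bounded_lattice_coord S : bounded_lattice R S ->
  exists N : nat, forall x i, S x -> (`|x 0%R i| <= N)%N.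
Proof.
(* [bounded_set] bounds the norms by every real strictly above [M], hence [M + 1]; the sup norm
   dominates each coordinate. *)
move=> [M [_ SM]]; exists (Num.truncn (M + 1)).+1 => x i Sx.
have xM : `|to_real R x| <= M + 1 by apply: SM; [rewrite ltrDl|exists x].
rewrite -(ler_nat R) natr_absz intr_norm (le_trans _ (ltW (truncnS_gt _)))//.
apply: le_trans xM; rewrite [leRHS]/Num.norm/= mx_normrE.
by apply/bigmax_geP; right; exists (0, i); rewrite //= mxE.
Qed.

Lemma lattice_length_le_diam S x y : bounded_lattice R S -> S x -> S y ->
  (lattice_length R x y <= lattice_diam R S)%N.
Proof.
move=> /bounded_lattice_coord[N SN] Sx Sy.
rewrite /lattice_diam; set A := [set n | _].
have Axy : A (lattice_length R x y) by exists x, y.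
(* Coordinates of a difference are at most [N + N] in absolute value, and a nonzero one bounds the
   gcd. *)
have AN : ubound A (N + N)%N.
  move=> _ [p [q [Sp Sq ->]]]; rewrite lattice_lengthE; apply: row_gcd_le => i.
  by rewrite !mxE; move: (p 0 i) (q 0 i) (SN _ i Sp) (SN _ i Sq) => a b; lia.
by have [_] := nat_maxP (ex_intro _ _ Axy) AN; apply.
Qed.

Lemma diam_quotient S x y : attains_diam R S x y ->
  y = x + (lattice_diam R S)%:Z *: primitive_row (y - x).
Proof.
by case=> _ _ <-; rewrite lattice_lengthE scale_primitive_row addrC subrK.
Qed.

Lemma eq_of_double_diam S x y w : bounded_lattice R S -> S x -> S y ->
  y - x = (2 * lattice_diam R S)%:Z *: w -> x = y.
Proof.
move=> bS Sx Sy xyE; have := lattice_length_le_diam bS Sx Sy.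
rewrite lattice_lengthE xyE row_gcd_scale => le_diam.
apply/esym/eqP; rewrite -subr_eq0 xyE.
have [->|D0] := posnP (lattice_diam R S); first by rewrite scale0r.
(* With [D > 0] the diameter, [2 * D * row_gcd w <= D] leaves only 0. *)
have /row_gcd0-> : row_gcd w = 0%N by nia.
by rewrite scaler0.
Qed.

Definition odd_support (v : 'rV[int]_d) : {set 'I_d} :=
  finset (fun i => (v 0%R i %% 2)%Z == 1).

Lemma odd_supportP v w : odd_support v = odd_support w ->
  exists u, v - w = 2%:Z *: u.
Proof.
move=> /setP vw; exists (\row_i ((v 0%R i - w 0%R i) %/ 2)%Z).
apply/rowP => i; rewrite !mxE; have := vw i; rewrite !inE.
by move: (v 0 i) (w 0 i) => a b; lia.
Qed.

Lemma card_attains_diam S x : (1 <= d)%N -> bounded_lattice R S -> S x ->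
  [set y | attains_diam R S x y] #<= `I_(2 ^ d - 1).
Proof.
move=> d1 bS Sx; set A := [set y | _].
have [D0|D0] := eqVneq (lattice_diam R S) 0%N.
  (* For diameter 0 the only candidate is [y = x], and [1 <= 2 ^ d - 1] since [d >= 1]. *)
  apply: (@card_le_trans _ _ _ [set x]).
    by apply: subset_card_le => y /diam_quotient; rewrite D0 scale0r addr0.
  rewrite (card_le_eql card_set1) card_le_II.
  by rewrite subn_gt0 -{1}(expn0 2) ltn_exp2l.
pose f y := index (odd_support (primitive_row (y - x))) (nonempty_sets d).
have gapE y z : A y -> A z ->
    odd_support (primitive_row (y - x)) = odd_support (primitive_row (z - x)) ->
    y = z.
  move=> Ay Az /esym/odd_supportP[u uE].
  have [_ Sy _] := Ay; have [_ Sz _] := Az.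
  apply: (@eq_of_double_diam S y z u bS Sy Sz).
  rewrite {1}(diam_quotient Ay) {1}(diam_quotient Az) opprD addrACA subrr add0r.
  by rewrite -scalerBr uE scalerA PoszM mulrC.
(* An empty support would make [y - x] an even multiple of the diameter, so [y = x] and the diameter
   would be 0. *)
have fI y : A y -> odd_support (primitive_row (y - x)) \in nonempty_sets d.
  move=> Ay; rewrite mem_enum; apply: contra_neqT D0.
  rewrite negbK => /eqP y0; have [_ Sy] := Ay.
  have /odd_supportP[u uE] :
      odd_support (primitive_row (y - x)) = odd_support 0.
    by rewrite y0; apply/setP => i; rewrite !inE mxE.
  have yx : x = y.
    apply: (@eq_of_double_diam S x y u bS Sx Sy); rewrite {1}(diam_quotient Ay).
    by rewrite addrAC subrr add0r -[primitive_row _]subr0 uE scalerA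
       PoszM mulrC.
  by move=> <-; rewrite lattice_lengthE -yx subrr /row_gcd big1// =>
    i _; rewrite mxE.
have finj : {in A &, injective f}.
  move=> y z; rewrite !inE => Ay Az fyz; apply: (gapE _ _ Ay Az).
  by rewrite -(nth_index finset.set0 (fI _ Ay)) -/(f y) fyz nth_index// fI.
rewrite -(card_le_eql (inj_card_eq finj)); apply: subset_card_le => _ [y Ay <-].
by rewrite /= -size_nonempty_sets index_mem fI.
Qed.

(** * Extremality of the cube *)

Definition indicator_row (A : {set 'I_d}) : 'rV[int]_d := \row_i (i \in A)%:Z.

Definition cube : set 'rV[int]_d := range indicator_row.

Lemma indicator_row0 : indicator_row finset.set0 = 0.
Proof. by apply/rowP => i; rewrite !mxE inE. Qed.

Lemma bounded_cube : bounded_lattice R cube.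
Proof.
exists 1; split; first exact: num_real.
move=> M M1 _ [_ [A _ <-] <-]; rewrite /= [leLHS]/Num.norm/= mx_normrE.
apply: bigmax_le => [|[j i] _]; first exact: le_trans (ltW M1).
by rewrite /= !mxE; case: (i \in A); rewrite ?normr1 ?normr0 ?(ltW M1)//
  (le_trans _ (ltW M1)).
Qed.

Lemma cube_length x y : cube x -> cube y -> (lattice_length R x y <= 1)%N.
Proof.
move=> [A _ <-] [B _ <-]; rewrite lattice_lengthE; apply: row_gcd_le => i.
by rewrite !mxE; case: (_ \in _); case: (_ \in _).
Qed.

(** The gcd divides a coordinate equal to 1. *)
Lemma cube_length0 A : A != finset.set0 ->
  lattice_length R 0 (indicator_row A) = 1%N.
Proof.
move=> /set0Pn[i iA]; rewrite lattice_lengthE subr0; apply/eqP.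
by have := row_gcd_dvd (indicator_row A) i; rewrite mxE iA dvdn1.
Qed.

Lemma cube_diam : (1 <= d)%N -> lattice_diam R cube = 1%N.
Proof.
move=> d1; have T0 : [set: 'I_d]%SET != finset.set0.
  by apply/set0Pn; exists (Ordinal d1).
apply: nat_max_eq; last by move=> _ [x [y [Sx Sy ->]]]; exact: cube_length.
exists 0, (indicator_row [set: 'I_d]%SET); split; [|by eexists|].
  by exists finset.set0; rewrite // indicator_row0.
by rewrite cube_length0.
Qed.

(** The endpoint [indicator_row B] is a multiple of [indicator_row A], so it vanishes off [A].
    Applied both ways, this makes segments from the origin to distinct nonzero vertices distinct. *)
Lemma segment_indicator_inj A B : B != finset.set0 ->
  @segment R d 0 (indicator_row A) = segment 0 (indicator_row B) ->
  B \subset A.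
Proof.
move=> B0 AB.
have : @segment R d 0 (indicator_row A) (to_real R (indicator_row B)).
  rewrite AB segmentE; exists 1; first by rewrite /= ler01 lexx.
  by apply/rowP => i; rewrite !mxE mul1r rmorphB/= addrC subrK.
rewrite segmentE => -[t _ /rowP tE]; apply/fintype.subsetP => i iB.
have := tE i; rewrite !mxE iB subr0; case: (i \in A) => //=.
by rewrite mulr0 addr0 => /eqP; rewrite eq_sym oner_eq0.
Qed.

Lemma card_diam_segments_cube : (1 <= d)%N ->
  `I_(2 ^ d - 1) #<= diam_segments_at R cube 0.
Proof.
move=> d1; pose s k := nth finset.set0 (nonempty_sets d) k.
have s0 k : `I_(2 ^ d - 1) k -> s k != finset.set0.
  move=> kd; have : s k \in nonempty_sets d.
    by rewrite mem_nth// size_nonempty_sets.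
  by rewrite mem_enum.
pose f k := @segment R d 0 (indicator_row (s k)).
have finj : {in `I_(2 ^ d - 1) &, injective f}.
  move=> j k; rewrite !inE => jd kd fjk.
  have /eqP : s j = s k.
    apply/eqP; rewrite finset.eqEsubset.
    by rewrite !segment_indicator_inj// ?s0.
  by rewrite nth_uniq ?size_nonempty_sets ?enum_uniq// => /eqP.
rewrite -(card_le_eql (inj_card_eq finj)); apply: subset_card_le => _ [k kd <-].
exists (indicator_row (s k)); split => //; split; [|by exists (s k)|].
  by exists finset.set0; rewrite // indicator_row0.
by rewrite cube_diam// cube_length0// s0.
Qed.

End Diameter.
End LatticeDiameter.

Theorem lemma4p6 (R : realType) (d : nat) (hd : (1 <= d)%N) :
  [/\ (forall (S : set 'rV[int]_d) (x : 'rV[int]_d),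
         bounded_lattice R S -> S x ->
         diam_segments_at R S x #<= `I_(2 ^ d - 1)),
      (forall S : set 'rV[int]_d,
         bounded_lattice R S -> S !=set0 ->
         (max_degree (borsuk_graph R S) <= 2 ^ d - 1)%N)
    & exists (S : set 'rV[int]_d) (x : 'rV[int]_d),
        [/\ bounded_lattice R S, S x
          & diam_segments_at R S x #= `I_(2 ^ d - 1)]].
Proof.
have segments_le (S : set 'rV[int]_d) x : bounded_lattice R S -> S x ->
    diam_segments_at R S x #<= `I_(2 ^ d - 1).
  (* The segments at [x] are images under [segment x] of the points attaining the diameter from
     [x]. *)
  move=> bS Sx; apply: card_le_trans (card_attains_diam hd bS Sx).
  apply: card_le_trans (card_image_le (segment x) _).
  by apply: subset_card_le => _ [y [xy ->]]; exists y.
split=> // [S bS _|].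
  rewrite /max_degree /nat_max.
  (* The value is either the degree of some vertex [x] or the default 0, for which the bound is
     immediate. *)
  case: xgetP => [_ -> [[x Sx <-] _]|//].
  apply: geq_card_fset_set; apply: card_le_trans (card_attains_diam hd bS Sx).
  by apply: subset_card_le => y [].
have cube0 : @cube d 0%R by exists finset.set0; rewrite // indicator_row0.
have bcube := bounded_cube R d.
exists (@cube d), 0%R; split=> //.
by rewrite card_eq_le segments_le// card_diam_segments_cube.
Qed.
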